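(* Let $s,t\in\mathbb{C}$ with $t\neq 0$ and $0<|q|<1$, where $q=\varphi_{s,t}'/\varphi_{s,t}$, and let $u\in\mathbb{C}$. Then, as formal power series in $x$ (hence also as an identity of sums for every $x\in\mathbb{C}$ for which the series converge), $$\sum_{n=1}^{\infty}\genfrac{[}{]}{0pt}{}{2n}{n}_{q}\frac{(-u/t)^{\binom{n}{2}}}{(-\sqrt{q};q)_{n}(-q;q)_{n}(1-q^n)}\left(\frac{4}{\sqrt{-t\varphi_{s,t}}}\right)^{n}x^{n}=\frac{4(1-\sqrt{q})x}{(1-q)^2\sqrt{-t\varphi_{s,t}}}\;{}_{3}\Phi_{2}\left(\begin{array}{c} q\sqrt{q},q,q \\ q^2,q^2 \end{array};q,-\frac{u}{t},\frac{-4ux}{t\sqrt{-t\varphi_{s,t}}}\right).$$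
   Context: $\varphi_{s,t}=\frac{s+\sqrt{s^2+4t}}{2}$ and $\varphi_{s,t}'=\frac{s-\sqrt{s^2+4t}}{2}$ (for a fixed choice of the square root), so that $\varphi_{s,t}\varphi_{s,t}'=-t$; $q=\varphi_{s,t}'/\varphi_{s,t}$. Square roots $\sqrt q$ and $\sqrt{-t\varphi_{s,t}}$ are fixed once and for all. $(a;q)_0=1$ and $(a;q)_n=\prod_{k=0}^{n-1}(1-aq^k)$ for $n\ge1$; $(a_1,\dots,a_m;q)_n=(a_1;q)_n\cdots(a_m;q)_n$. The $q$-binomial coefficient is $\genfrac{[}{]}{0pt}{}{n}{k}_{q}=\frac{(q;q)_n}{(q;q)_k(q;q)_{n-k}}$. The deformed basic hypergeometric series is ${}_{r}\Phi_{r'}\left(\begin{array}{c} a_1,\ldots,a_r \\ b_1,\ldots,b_{r'} \end{array};q,v,z\right)=\sum_{n\ge0}v^{\binom n2}\frac{(a_1,\ldots,a_r;q)_n}{(q,b_1,\ldots,b_{r'};q)_n}\bigl[(-1)^nq^{\binom n2}\bigr]^{1+r'-r}z^n$; for $r=r'+1$ the bracketed factor is $1$. Convention: $0^0=1$. *)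

(* Defs.v *)
From HB Require Import structures.
From mathcomp Require Import all_boot all_order all_algebra.
From mathcomp Require Export complex.
From mathcomp Require Import all_classical all_reals all_analysis.

Set Implicit Arguments.
Unset Strict Implicit.
Unset Printing Implicit Defensive.

Import Order.TTheory GRing.Theory Num.Theory.
Import numFieldNormedType.Exports.

Local Open Scope ring_scope.

(* [R[i]] packed as a [numClosedFieldType]: the topology used in [cvgn] and
   [limn] is the one induced by the complex modulus. *)
Definition Cplx (R : realType) : numClosedFieldType := R[i].

(* The two roots of X^2 - s X - t, where [d] is the chosen square root of
   s^2 + 4 t. *)
Definition phi (K : fieldType) (s d : K) : K := (s + d) / 2%:R.
Definition phi' (K : fieldType) (s d : K) : K := (s - d) / 2%:R.

Definition qpoch (K : fieldType) (q a : K) (n : nat) : K :=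
  \prod_(k < n) (1 - a * q ^+ k).

Definition qpochs (K : fieldType) (q : K) (l : seq K) (n : nat) : K :=
  \prod_(a <- l) qpoch q a n.

(* Meant for k <= n and q not a root of unity. *)
Definition qbinom (K : fieldType) (q : K) (n k : nat) : K :=
  qpoch q q n / (qpoch q q k * qpoch q q (n - k)).

(* Coefficient of z^n in the deformed basic hypergeometric series with upper
   parameters [al] and lower parameters [bl]. The exponent 1 + r' - r may be
   negative, hence the integer power. *)
Definition dbhs_coef (K : fieldType) (al bl : seq K) (q v : K) (n : nat) : K :=
  v ^+ 'C(n, 2) * (qpochs q al n / qpochs q (q :: bl) n)
  * ((-1) ^+ n * q ^+ 'C(n, 2)) ^ (1 + (size bl)%:Z - (size al)%:Z).

Definition dbhs_series (K : numFieldType) (al bl : seq K) (q v z : K)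
  : nat -> K :=
  series (fun n : nat => dbhs_coef al bl q v n * z ^+ n).

Definition dbhs (K : numFieldType) (al bl : seq K) (q v z : K) : K :=
  limn (dbhs_series al bl q v z).

(* Formal power series in one indeterminate X, given by their coefficients. *)
Definition fps (K : fieldType) : Type := nat -> K.

Definition fps_mul (K : fieldType) (f g : fps K) : fps K :=
  fun n => \sum_(i < n.+1) f i * g (n - i)%N.

(* The formal power series c X. *)
Definition fps_scaleX (K : fieldType) (c : K) : fps K :=
  fun n => if n == 1%N then c else 0.

(* The formal power series f(c X). *)
Definition fps_subst (K : fieldType) (f : fps K) (c : K) : fps K :=
  fun n => f n * c ^+ n.

(* The formal power series \sum_(n >= 1) a n X^n; the value [a 0] is not
   used. *)
Definition fps_from1 (K : fieldType) (a : nat -> K) : fps K :=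
  fun n => if n == 0%N then 0 else a n.

(* Main.v *)
Require Import Defs.
From HB Require Import structures.
From mathcomp Require Import all_boot all_order all_algebra.
From mathcomp Require Import all_classical all_reals all_analysis.
From mathcomp Require Import ring.

Set Implicit Arguments.
Unset Strict Implicit.
Unset Printing Implicit Defensive.

Import Order.TTheory GRing.Theory Num.Theory.
Import numFieldNormedType.Exports.

Local Open Scope ring_scope.

(** Split the even and the odd powers of [q] in [(q; q)_(2n)]: with
    [p] the chosen square root [sq] of [q], the factor [1 - q^(2k+1)] is
    [(1 - p q^k) (1 + p q^k)] and the factor [1 - q^(2k+2)] is
    [(1 - q^(k+1)) (1 + q^(k+1))].  Hence
      [(q; q)_(2n) = (p; q)_n (-p; q)_n (q; q)_n (-q; q)_n],
    and the denominators [(-p; q)_n (-q; q)_n] of the left-hand side cancel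
    against the central q-binomial coefficient, leaving
    [(p; q)_n / (q; q)_n / (1 - q^n)].

    Writing [n = m + 1] and peeling off the first factor of each symbol,
    [(p; q)_n = (1 - p) (pq; q)_m] and [(q; q)_n = (1 - q) (q^2; q)_m], while
    [1 - q^n = (q; q)_n / (q; q)_m].  This produces the parameters of the
    3Phi2 series, and the Pascal rule [C(m+1, 2) = C(m, 2) + m] moves the
    surplus [v^m] into the argument of the series.  So the identity holds term
    by term, with the index shifted by one ([central_term_shift]).

    The analytic half follows because the partial sums of the two series are
    proportional ([sum_from1_shift]).  The ratio [kappa * x] is nonzero for
    [x != 0], so convergence passes both ways; at [x = 0] the two series have
    finitely many nonzero terms. *)

(** * q-Pochhammer symbols *)

Section QPochhammer.
Variable K : fieldType.
Implicit Types (q a p : K) (n : nat).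

Lemma qpoch0 q a : qpoch q a 0 = 1.
Proof. by rewrite /qpoch big_ord0. Qed.

Lemma qpochSr q a n : qpoch q a n.+1 = qpoch q a n * (1 - a * q ^+ n).
Proof. by rewrite /qpoch big_ord_recr. Qed.

Lemma qpochSl q a n : qpoch q a n.+1 = (1 - a) * qpoch q (q * a) n.
Proof.
rewrite /qpoch big_ord_recl expr0 mulr1; congr (_ * _).
by apply: eq_bigr => i _; rewrite exprS; congr (1 - _); ring.
Qed.

(** The factors with odd and with even powers of [q] are differences of two
    squares. *)
Lemma qpoch_double q p n : p ^+ 2 = q ->
  qpoch q q n.*2 =
  qpoch q p n * qpoch q (- p) n * (qpoch q q n * qpoch q (- q) n).
Proof.
move=> pq; elim: n => [|n IHn]; first by rewrite !qpoch0 !mulr1.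
rewrite doubleS !qpochSr IHn exprS -addnn exprD -pq; ring.
Qed.

End QPochhammer.

Lemma qpoch_neq0 (K : numFieldType) (q a : K) (n : nat) :
  `|q| <= 1 -> `|a| < 1 -> qpoch q a n != 0.
Proof.
move=> q1 a1; apply/prodf_neq0 => i _; rewrite subr_eq0 eq_sym.
apply: contraTneq a1 => aq1; rewrite -real_leNgt ?normr_real ?real1 //.
by rewrite -(normr1 K) -aq1 normrM normrX ler_piMr ?exprn_ile1.
Qed.

(** * The termwise identity *)

(** The bounds on [q] and [p] serve only to keep the cancelled denominators
    nonzero.  The theorem takes [b = 4 / w]; the argument of the series is then
    [v * b * x], the factor [v] being the one split off by the Pascal rule. *)
Lemma central_term_shift (K : numFieldType) (q p v b : K) (m : nat) :
  p ^+ 2 = q -> `|q| < 1 ->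
  qbinom q m.+1.*2 m.+1 *
    (v ^+ 'C(m.+1, 2) /
       (qpoch q (- p) m.+1 * qpoch q (- q) m.+1 * (1 - q ^+ m.+1))) *
    b ^+ m.+1
  = (1 - p) / (1 - q) ^+ 2 * b *
    (dbhs_coef [:: q * p; q; q] [:: q ^+ 2; q ^+ 2] q v m * (v * b) ^+ m).
Proof.
move=> pq q1.
have p1 : `|p| < 1 by rewrite -(@expr_lt1 _ 2) // -normrX pq.
have qle1 : `|q| <= 1 := ltW q1.
have nz a n : `|a| < 1 -> qpoch q a n != 0 by exact: qpoch_neq0.
have Np : qpoch q (- p) m.+1 != 0 by rewrite nz ?normrN.
have Nq : qpoch q (- q) m.+1 != 0 by rewrite nz ?normrN.
have Q1 := nz q m.+1 q1.
have Qm := nz q m q1.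
have := Q1; rewrite qpochSl mulf_eq0 negb_or -expr2 => /andP[q_ne1 Q2m].
have := Q1; rewrite qpochSr mulf_eq0 negb_or -exprS => /andP[_ qm_ne1].
(* The first and the last factor of [(q; q)_(m+1)] give two forms of it. *)
have eQ : qpoch q q m * (1 - q ^+ m.+1) = (1 - q) * qpoch q (q ^+ 2) m.
  by rewrite exprS -qpochSr qpochSl expr2.
rewrite /qbinom -addnn addnK addnn (qpoch_double _ pq) (qpochSl q p).
rewrite /dbhs_coef /qpochs !big_cons !big_nil expr0z !mulr1.
rewrite binS bin1 exprD exprMn (exprS b).
rewrite (qpochSl q q) -expr2.
have -> : 1 - q ^+ m.+1 = (1 - q) * qpoch q (q ^+ 2) m / qpoch q q m.
  by rewrite -eQ mulrAC mulfV ?mul1r.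
by field; rewrite Np Nq q_ne1 Q2m Qm.
Qed.

(** * Series with proportional shifted terms *)

Lemma sum_from1_shift (K : numFieldType) (f g : nat -> K) (k : K) (N : nat) :
  (forall n, f n.+1 = k * g n) ->
  \sum_(1 <= n < N.+1) f n = k * series g N.
Proof.
move=> fg; rewrite big_add1 /= /series /= mulr_sumr.
by apply: eq_bigr => i _; exact: fg.
Qed.

Lemma lim_sum_from1_shift (K : numFieldType) (f g : nat -> K) (k : K) :
  (forall n, f n.+1 = k * g n) -> cvgn (series g) ->
  cvgn (fun N => \sum_(1 <= n < N) f n) /\
  \big[+%R/0]_(1 <= n <oo) f n = k * limn (series g).
Proof.
move=> fg cg.
have cf : ((fun N => \sum_(1 <= n < N) f n) @ \oo --> k * limn (series g))%classic.
  rewrite -cvg_shiftS; under eq_fun => N do rewrite (sum_from1_shift N fg).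
  exact: cvgMr.
by split; [apply/cvg_ex; exists (k * limn (series g)) | exact: cvg_lim].
Qed.

(** The converse transfer of convergence divides by [k]; for [k = 0] the first
    series carries no information on the second. *)
Lemma cvg_series_of_shift (K : numFieldType) (f g : nat -> K) (k : K) :
  k != 0 -> (forall n, f n.+1 = k * g n) ->
  cvgn (fun N => \sum_(1 <= n < N) f n) -> cvgn (series g).
Proof.
move=> k0 fg /cvg_ex[l cf]; apply/cvg_ex; exists (k^-1 * l).
have -> : series g = fun N => k^-1 * \sum_(1 <= n < N.+1) f n.
  by apply/funext => N; rewrite (sum_from1_shift N fg) mulKf.
by apply: cvgMr; rewrite (cvg_shiftS (fun N => \sum_(1 <= n < N) f n)).
Qed.

(** The case where the two series are not proportional by a nonzero factor:
    only the constant term survives. *)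
Lemma cvg_dbhs_series0 (K : numFieldType) (al bl : seq K) (q v : K) :
  cvgn (dbhs_series al bl q v 0).
Proof.
apply/cvg_ex; exists (dbhs_coef al bl q v 0).
rewrite -cvg_shiftS; under eq_fun => N.
  rewrite /dbhs_series /series /= big_nat_recl //= expr0 mulr1.
  rewrite big1 ?addr0; last by move=> i _; rewrite exprS mul0r mulr0.
  over.
exact: cvg_cst.
Qed.

(** * The generating function of the central q-binomial coefficients *)

Theorem theorem7 (R : realType) (s t u d q sq w : Cplx R)
    (hd : d ^+ 2 = s ^+ 2 + 4%:R * t)
    (hq : q = phi' s d / phi s d)
    (hsq : sq ^+ 2 = q)
    (hw : w ^+ 2 = - t * phi s d)
    (ht : t != 0)
    (hq01 : 0 < `|q| < 1) :
  let a : nat -> Cplx R := fun n =>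
    qbinom q n.*2 n *
    ((- u / t) ^+ 'C(n, 2) /
       (qpoch q (- sq) n * qpoch q (- q) n * (1 - q ^+ n))) *
    (4%:R / w) ^+ n in
  let al : seq (Cplx R) := [:: q * sq; q; q] in
  let bl : seq (Cplx R) := [:: q ^+ 2; q ^+ 2] in
  let v : Cplx R := - (u / t) in
  let kappa : Cplx R := 4%:R * (1 - sq) / ((1 - q) ^+ 2 * w) in
  let c : Cplx R := - 4%:R * u / (t * w) in
  fps_from1 a
    = fps_mul (fps_scaleX kappa) (fps_subst (dbhs_coef al bl q v) c)
  /\
  forall x : Cplx R,
    cvgn (fun N : nat => \sum_(1 <= n < N) a n * x ^+ n : Cplx R) \/
    cvgn (dbhs_series al bl q v (c * x)) ->
    [/\ cvgn (fun N : nat => \sum_(1 <= n < N) a n * x ^+ n : Cplx R),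
        cvgn (dbhs_series al bl q v (c * x)) &
        \big[+%R/0]_(1 <= n <oo) (a n * x ^+ n)
          = kappa * x * dbhs al bl q v (c * x)].
Proof.
move=> a al bl v kappa c.
have [q_gt0 q1] := andP hq01.
have q0 : q != 0 by rewrite -normr_gt0.
have w0 : w != 0.
  rewrite -sqrf_eq0 hw mulf_neq0 ?oppr_eq0 //.
  (* Division by zero yields zero, so [phi = 0] would force [q = 0]. *)
  by apply: contraNneq q0 => phi0; rewrite hq phi0 invr0 mulr0.
have ne1 (y : Cplx R) : `|y| < 1 -> 1 - y != 0.
  by move=> y1; rewrite subr_eq0; apply: contraTneq y1 => <-; rewrite normr1 ltxx.
have sq1 : `|sq| < 1 by rewrite -(@expr_lt1 _ 2) // -normrX hsq.
(* [1 - sq] is nonzero because [sq] also lies in the unit disc. *)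
have kappa0 : kappa != 0.
  by rewrite !mulf_neq0 ?invr_eq0 ?mulf_neq0 ?expf_neq0 ?pnatr_eq0 ?ne1.
have aS m : a m.+1 = kappa * (dbhs_coef al bl q v m * c ^+ m).
  have -> : c = v * (4%:R / w) by rewrite /c /v invfM; ring.
  have -> : kappa = (1 - sq) / (1 - q) ^+ 2 * (4%:R / w).
    by rewrite /kappa invfM; ring.
  by rewrite /a mulNr; exact: central_term_shift.
(* Only [aS] and [kappa0] matter from here on. *)
clearbody a al bl v kappa c.
split.
  apply/funext => -[|m]; rewrite /fps_from1 /fps_mul /fps_scaleX /fps_subst /=.
    by rewrite big_ord1 mul0r.
  rewrite aS (bigD1 (inord 1)) //= inordK // eqxx subn1 /= big1 ?addr0 //.
  move=> i; rewrite -val_eqE /= inordK // => /negPf ->; exact: mul0r.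
move=> x cvg_one.
have axS m : a m.+1 * x ^+ m.+1 =
    kappa * x * (dbhs_coef al bl q v m * (c * x) ^+ m).
  by rewrite aS (exprS x) mulrACA -(mulrA (dbhs_coef _ _ _ _ _)) -exprMn.
have cg : cvgn (dbhs_series al bl q v (c * x)).
  have [->|x0] := eqVneq x 0; first by rewrite mulr0; exact: cvg_dbhs_series0.
  case: cvg_one => [cf|//].
  exact: (cvg_series_of_shift (f := fun n => a n * x ^+ n)
    (mulf_neq0 kappa0 x0) axS cf).
have [cf eq_lim] :=
  lim_sum_from1_shift (f := fun n => a n * x ^+ n) axS cg.
by split.
Qed.
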